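(* Let $F\in C_c(\mathbb{R})$ and, for $N\ge 3$ and $n\in\mathbb{N}$, put $\varphi_N(n)=\dfrac{\Omega(n)-\log\log N}{\sqrt{\log\log N}}$. Then for any bounded arithmetic function $a$ with values in $\mathbb{C}$, $$\frac1N\sum_{n=1}^N F(\varphi_N(n))\,a(\Omega(n))=\frac1N\sum_{n=1}^N F(\varphi_N(n))\,a(\Omega(n)+1)+o(1)\qquad\text{as }N\to\infty.$$
   Context: For $n\in\mathbb{N}=\{1,2,\dots\}$, $\Omega(n)$ denotes the number of prime factors of $n$ counted with multiplicity. $C_c(\mathbb{R})$ is the set of continuous compactly supported functions on $\mathbb{R}$. Since $\Omega(1)=0$, the arithmetic function $a$ is taken to be defined on $\{0,1,2,\dots\}$ (the value $a(0)$ enters only through the term $n=1$). *)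

(* Defs.v *)
From HB Require Import structures.
From mathcomp Require Import all_boot all_order all_algebra.
From mathcomp Require Import all_classical all_reals all_analysis.
From mathcomp Require Import complex.
Set Implicit Arguments.
Unset Strict Implicit.
Unset Printing Implicit Defensive.
Import Order.TTheory GRing.Theory Num.Theory numFieldNormedType.Exports.
Local Open Scope classical_set_scope.
Local Open Scope ring_scope.
Local Open Scope complex_scope.

(* [R[i]] carries no canonical topology in the library; this is the one
   induced by the modulus, as on every [numFieldType]. *)
HB.instance Definition _ (R : rcfType) := NormedModule.copy R[i] R[i]^o.

(* [prime_Omega 0 = 0]; only positive arguments matter. *)
Definition prime_Omega (n : nat) : nat := (\sum_(p <- primes n) logn p n)%N.

(* The constraint 3 <= N, which makes ln (ln N) positive, is not imposed:
   smaller N do not affect a limit N --> oo. *)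
Definition phi (R : realType) (N n : nat) : R :=
  ((prime_Omega n)%:R - ln (ln N%:R)) / Num.sqrt (ln (ln N%:R)).

Definition Cc (R : realType) : set (R -> R[i]) :=
  [set F | continuous F /\ compact (closure [set x | F x != 0])].

(* Main.v *)
Require Import Defs.
From mathcomp Require Import all_boot all_order all_algebra.
From mathcomp Require Import all_classical all_reals all_analysis.
From mathcomp Require Import complex.
From mathcomp Require Import zify ring lra.
Set Implicit Arguments.
Unset Strict Implicit.
Unset Printing Implicit Defensive.
Import Order.TTheory GRing.Theory Num.Theory numFieldNormedType.Exports.
Local Open Scope classical_set_scope.
Local Open Scope ring_scope.
Local Open Scope complex_scope.

(** Write [mean g x] for the average of [g (prime_Omega n)] over the positive
    integers [n <= x].  The heart of the matter is [mean_shift]: as [x] grows,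
    [mean g x] and [mean (g \o succn) x] become equal, uniformly in all real
    [g] bounded by 1.  Uniformity is what the theorem needs, since it is
    applied with a [g] that changes with [N], namely
    [g k = f ((k - L) / sqrt L) * a k] where [L = ln (ln N)] and [f] is the real
    or imaginary part of [F].  Passing from [k] to [k + 1] moves the argument
    of [f] by [1 / sqrt L], which tends to 0, so that uniform continuity of [f]
    turns [g (k + 1)] into [f ((k - L) / sqrt L) * a (k + 1)].

    With [F] close to the constant 1 and [a k = (-1) ^ k] the theorem says that
    the Liouville function has mean value 0, a statement from which the prime
    number theorem follows by elementary means.  The argument therefore has to
    use some information about the distribution of primes; it needs only
    Chebyshev-type bounds.

    The first ingredient is the Turan-Kubilius inequality in dual form,
    [turan_kubilius_mean]: if weights [c p] on finitely many primes have sum 1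
    and [\sum_p c p ^+ 2 * p] is small, then a typical [n] has about as many
    prime divisors, counted with weight [c p * p], as expected, and therefore
    [mean g x] is close to [\sum_p c p * mean (g \o succn) (x / p)], because
    [prime_Omega (p * n) = (prime_Omega n).+1].

    This reduces [mean_shift] to replacing [x / p] by [x], that is, to
    [mean_dilate]: the means vary so slowly that [mean g (x * y)] and
    [mean g x] agree in the limit for [y] in a bounded range.  To see this, take
    two samples of primes such that the second is the first one dilated by some
    [r > 1], up to a relative precision far smaller than [r - 1].  Applying the
    first ingredient at [x] with the one sample and at [x * r] with the other
    expresses both means by the same averages, so [mean g x] and [mean g (x * r)]
    differ by much less than [r - 1] ([mean_dilate_ratio]).  Reaching [x * y]
    takes at most [y / (r - 1)] such steps, so the total error remains small.

    Such samples exist because primes do not cluster.  Cut the scale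
    [8 ^ m < p <= 8 ^ m.+1] into cells of equal width.  By Chebyshev's argument
    the scale contains at least a constant times [8 ^ m / m] primes
    ([primes_in_lower]).  On the other hand every prime in [x < p <= x + h]
    divides ['C(x + h, h)], which bounds the number of primes in a short
    interval by an arbitrarily small multiple of [x / m] ([primes_in_short]).
    Hence the primes cannot sit in a short run of neighbouring cells, and two
    cells that are close, but many cells apart, both contain their share of
    primes ([rich_pair]).  There are finitely many positions for the two cells,
    and [\sum_m 1 / m] diverges, so one position serves so many scales [m] that
    the weights needed for the Turan-Kubilius inequality exist
    ([rich_scales]). *)

(** * Primes in intervals *)

Section PrimesInCells.
Local Open Scope nat_scope.

Definition primes_in (a b : nat) : seq nat :=
  [seq p <- index_iota a.+1 b.+1 | prime p].

Lemma mem_primes_in a b p : (p \in primes_in a b) = (a < p <= b) && prime p.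
Proof. by rewrite mem_filter mem_index_iota ltnS andbC. Qed.

Lemma primes_in_uniq a b : uniq (primes_in a b).
Proof. by rewrite filter_uniq // iota_uniq. Qed.

Lemma primes_in_cat a b c : a <= b -> b <= c ->
  primes_in a c = primes_in a b ++ primes_in b c.
Proof.
move=> ab bc; rewrite -filter_cat /index_iota; congr [seq p <- _ | prime p].
rewrite [X in _ ++ iota X _](_ : _ = a.+1 + (b.+1 - a.+1)); last lia.
by rewrite -iotaD; congr iota; lia.
Qed.

Lemma size_primes_in_cat a b c : a <= b -> b <= c ->
  size (primes_in a c) = size (primes_in a b) + size (primes_in b c).
Proof. by move=> ab bc; rewrite (primes_in_cat ab bc) size_cat. Qed.

Lemma sum_size_primes_in W u v : u <= v ->
  \sum_(u <= b < v) size (primes_in (b * W) (b.+1 * W))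
  = size (primes_in (u * W) (v * W)).
Proof.
elim: v => [|v IH] uv.
  have -> : u = 0 by lia.
  rewrite big_geq //= /primes_in /index_iota mul0n subnn //.
move: uv; rewrite leq_eqVlt => /predU1P [->|uv].
  by rewrite big_geq // /primes_in /index_iota subnn.
rewrite big_nat_recr //= IH // -size_primes_in_cat //; first by rewrite leq_mul2r -ltnS uv orbT.
by rewrite leq_mul2r leqnSn orbT.
Qed.

Lemma prod_primes_dvd (s : seq nat) c : uniq s -> all prime s ->
  all (fun p => p %| c) s -> \prod_(p <- s) p %| c.
Proof.
elim: s => [|p s IH] /=; first by rewrite big_nil.
move=> /andP[ps us] /andP[pp prs] /andP[pc sc]; rewrite big_cons.
rewrite Gauss_dvd ?pc ?IH //.
rewrite prime_coprime // big_seq; apply: (big_ind (fun x => ~~ (p %| x))) => [|x y xp yp|q qs].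
- by rewrite Euclid_dvd1.
- by rewrite Euclid_dvdM // negb_or xp.
rewrite dvdn_prime2 //; last exact: (allP prs).
by apply: contraNneq ps => ->.
Qed.

Lemma prime_dvd_fact p n : prime p -> p %| n`! -> p <= n.
Proof.
move=> pp; elim: n => [|n IH]; first by rewrite fact0 Euclid_dvd1.
rewrite factS Euclid_dvdM // => /orP[/dvdn_leq|/IH]; last lia.
by move=> /(_ isT).
Qed.

(** A prime in this range divides [(x + h)`!] but, being larger than [x] and [h],
    neither [x`!] nor [h`!]. *)
Lemma prod_primes_in_le_bin x h : h <= x ->
  \prod_(p <- primes_in x (x + h)) p <= 'C(x + h, h).
Proof.
move=> hx; apply: dvdn_leq; first by rewrite bin_gt0 leq_addl.
apply: prod_primes_dvd; first exact: primes_in_uniq.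
  by apply/allP => p; rewrite mem_primes_in => /andP[].
apply/allP => p; rewrite mem_primes_in => /andP[/andP[xp ph] pp].
have : p %| (x + h)`! by rewrite dvdn_fact // prime_gt0.
rewrite -(bin_fact (leq_addl x h)) addnK !Euclid_dvdM //.
by case/or3P => // /(prime_dvd_fact pp) ?; lia.
Qed.

Lemma bin_le_exp2 n k : 'C(n, k) <= 2 ^ n.
Proof.
rewrite -[2]/(1 + 1) expnDn.
case: (leqP k n) => [kn|/bin_small -> //].
rewrite (bigD1 (Ordinal (kn : k < n.+1))) //= !exp1n !muln1; lia.
Qed.

(** [h ^ h] is at most the product of [h + 1, ..., 2 * h], which is
    ['C(2 * h, h) * h`!]. *)
Lemma expn_le_fact h : h ^ h <= 4 ^ h * h`!.
Proof.
have: h ^ h <= 'C(h + h, h) * h`!.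
  rewrite bin_ffact ffact_prod -{2}[h]card_ord -prod_nat_const.
  by apply: leq_prod => i _; have := ltn_ord i; lia.
move=> /leq_trans; apply; rewrite leq_mul2r; apply/orP; right.
by apply: leq_trans (bin_le_exp2 _ _) _; rewrite addnn -mul2n expnM.
Qed.

Lemma bin_expn_le n h : 'C(n, h) * h ^ h <= (4 * n) ^ h.
Proof.
apply: leq_trans (leq_mul (leqnn _) (expn_le_fact h)) _.
rewrite mulnCA bin_ffact expnMn leq_mul2l; apply/orP; right.
rewrite ffact_prod.
suff : \prod_(i < h) (n - i) <= \prod_(i < h) n by rewrite prod_nat_const card_ord.
by apply: leq_prod => i _; exact: leq_subr.
Qed.

Lemma expn_size_le_prod a (s : seq nat) :
  {in s, forall p, a <= p} -> a ^ size s <= \prod_(p <- s) p.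
Proof.
elim: s => [|p s IH] H; first by rewrite big_nil.
rewrite big_cons /= expnS leq_mul ?H ?mem_head // IH // => q qs.
by rewrite H // inE qs orbT.
Qed.

(** A sieve-free substitute for the Brun-Titchmarsh inequality: the factor
    [(r + 6) / 2 ^ r] is not the expected [1 / 2 ^ r], but it tends to 0 with
    the relative length of the interval, and this is enough to prevent
    clustering. *)
Lemma primes_in_short m r x : r <= 3 * m ->
  2 ^ (3 * m) <= x < 8 * 2 ^ (3 * m) ->
  3 * m * size (primes_in x (x + 2 ^ (3 * m - r))) <= (r + 6) * 2 ^ (3 * m - r).
Proof.
move=> rm; set h := 2 ^ (3 * m - r); set X := 2 ^ (3 * m).
move=> /andP[Xx xX].
have h0 : 0 < h by rewrite expn_gt0.
have XE : X = 2 ^ r * h by rewrite /X /h -expnD; congr (2 ^ _); lia.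
have hX : h <= X by rewrite XE leq_pmull // expn_gt0.
set n := size _.
have : X ^ n * h ^ h <= (2 ^ (r + 6) * h) ^ h.
  have X1: X ^ n <= 'C(x + h, h).
    apply: leq_trans (prod_primes_in_le_bin (leq_trans hX Xx)).
    by apply: expn_size_le_prod => p; rewrite mem_primes_in; lia.
  apply: leq_trans (leq_mul X1 (leqnn _)) _.
  apply: leq_trans (bin_expn_le _ _) _.
  rewrite leq_exp2r // expnD (_ : 2 ^ 6 = 64) // -mulnA (mulnC 64) mulnA -XE; lia.
rewrite expnMn leq_pmul2r ?expn_gt0 ?h0 //.
by rewrite -expnM /X -expnM leq_exp2l.
Qed.

(** Each dyadic block of primes is controlled by a central binomial coefficient. *)
Lemma primorial_dyadic K : \prod_(p <- primes_in 0 (2 ^ K)) p <= 2 ^ (2 ^ K.+1).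
Proof.
elim: K => [|K IH]; first by rewrite /primes_in /index_iota /= !big_nil.
rewrite (@primes_in_cat 0 (2 ^ K)) ?leq_exp2l // big_cat /=.
rewrite [X in _ <= 2 ^ X](_ : _ = 2 ^ K.+1 + 2 ^ K.+1); last by rewrite expnS; lia.
rewrite expnD leq_mul //.
have E : 2 ^ K.+1 = 2 ^ K + 2 ^ K by rewrite expnS; lia.
apply: leq_trans (bin_le_exp2 _ (2 ^ K)); rewrite E.
exact: prod_primes_in_le_bin.
Qed.

Lemma exp2_le_central_bin n : 2 ^ n <= 'C(n + n, n).
Proof.
rewrite -(leq_pmul2r (fact_gt0 n)) bin_ffact ffact_prod.
rewrite fact_prod big_add1 /= big_mkord -{1}[n]card_ord -prod_nat_const -big_split /=.
rewrite [X in _ <= X](reindex_inj rev_ord_inj) /=.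
by apply: leq_prod => i _; have := ltn_ord i; lia.
Qed.

(** In Legendre's formula for ['C(n + n, n)] each exponent [k] with
    [p ^ k <= n + n] contributes at most 1, and the others contribute 0. *)
Lemma prime_power_central_bin p n : prime p -> 0 < n ->
  p ^ logn p 'C(n + n, n) <= n + n.
Proof.
move=> pp n0.
have tlb := trunc_log_bounds (prime_gt1 pp) (_ : 0 < n + n).
have {tlb}/andP[tl1 tl2] := tlb ltac:(lia).
apply: (leq_trans _ tl1); rewrite leq_exp2l ?prime_gt1 //.
have := congr1 (logn p) (bin_fact (leq_addl n n)).
rewrite addnK !lognM ?bin_gt0 ?leq_addl ?muln_gt0 ?fact_gt0 // !logn_fact //.
set L := trunc_log p (n + n) in tl2 *.
have -> : \sum_(1 <= k < n.+1) n %/ p ^ k = \sum_(1 <= k < (n + n).+1) n %/ p ^ k.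
  rewrite [RHS](big_cat_nat (n := n.+1)) ?ltnS ?leq_addr //=.
  rewrite [X in _ = _ + X]big_nat_cond [X in _ = _ + X]big1 ?addn0 // => k /andP[/andP[nk _] _].
  by rewrite divn_small // (leq_trans nk) // ltnW // ltn_expl // prime_gt1.
have : \sum_(1 <= k < (n + n).+1) (n + n) %/ p ^ k <=
   \sum_(1 <= k < (n + n).+1) (n %/ p ^ k + n %/ p ^ k + (k <= L)).
  rewrite big_nat [X in _ <= X]big_nat; apply: leq_sum => k k1.
  case: (leqP k L) => kL.
    by rewrite divnD ?expn_gt0 ?prime_gt0 // leq_add2l leq_b1.
  rewrite divn_small //; apply: leq_trans tl2 _.
  by rewrite leq_exp2l ?prime_gt1.
rewrite !big_split /=.
suff : \sum_(1 <= k < (n + n).+1) (k <= L) <= L by lia.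
have LM : L <= n + n.
  by apply: leq_trans tl1; rewrite ltnW // ltn_expl // prime_gt1.
rewrite (big_cat_nat (n := L.+1)) //=.
rewrite [X in _ + X]big_nat_cond [X in _ + X]big1; last first.
  by move=> k /andP[/andP[Lk _] _]; rewrite leqNgt Lk.
rewrite addn0; apply: (@leq_trans (\sum_(1 <= k < L.+1) 1)).
  by apply: leq_sum => k _; exact: leq_b1.
by rewrite sum_nat_const_nat subn1 muln1.
Qed.

Lemma leq_prod_seq (s : seq nat) f g : {in s, forall x, f x <= g x} ->
  \prod_(x <- s) f x <= \prod_(x <- s) g x.
Proof.
move=> fg; rewrite big_seq [X in _ <= X]big_seq.
by apply: (big_ind2 (fun a b => a <= b)) => // *; exact: leq_mul.
Qed.

Lemma prod_const_seq (s : seq nat) a : \prod_(x <- s) a = a ^ size s.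
Proof. by rewrite big_const_seq count_predT; elim: (size s) => //= n ->; rewrite expnS. Qed.

Lemma size_primes_in_le a b : size (primes_in a b) <= b - a.
Proof. by rewrite size_filter (leq_trans (count_size _ _)) // size_iota. Qed.

(** Chebyshev's lower bound.  With [X = 2 ^ (3 * m)] it compares
    [2 ^ (4 * X) <= 'C(8 * X, 4 * X)] with the prime factorization of the
    binomial coefficient, in which the primes up to [X] account for little more
    than [2 ^ (2 * X)]. *)
Lemma primes_in_lower m : 5 <= m ->
  2 ^ (3 * m) <= 3 * m.+1 * size (primes_in (2 ^ (3 * m)) (8 * 2 ^ (3 * m))).
Proof.
move=> m5; set X := 2 ^ (3 * m); set M := 8 * X; set Q := 2 ^ (2 * m).
have ME : M = 2 ^ (3 * m.+1) by rewrite /M /X -(expnD 2 3); congr (2 ^ _); lia.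
have m32 : 3 * m.+1 <= 2 ^ m.
  rewrite -(subnKC m5); elim: (m - 5) => // k.
  by rewrite addnS expnS; move: (2 ^ (5 + k)) => y; lia.
have XE : X = 2 ^ m * Q by rewrite /X /Q -expnD; congr (2 ^ _); lia.
have QX : Q <= X by rewrite XE leq_pmull // expn_gt0.
have QM : M <= Q * Q.
  rewrite ME /Q -expnD leq_exp2l //; lia.
have X0 : 0 < X by rewrite expn_gt0.
(* Primes up to Q enter C(n + n, n) with any exponent, but Q is so small that
   their contribution M ^ Q is negligible. *)
set n := 4 * X; have nnM : n + n = M by lia.
set c := 'C(n + n, n); have c0 : 0 < c by rewrite bin_gt0 leq_addl.
have pM p : prime p -> p ^ logn p c <= M.
  by move=> pp; rewrite -nnM prime_power_central_bin //; lia.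
(* A prime above the square root of M divides c at most once. *)
have pM1 p : prime p -> Q < p -> p ^ logn p c <= p.
  move=> pp Qp; rewrite -[X in _ <= X]expn1 leq_exp2l ?prime_gt1 // leqNgt.
  apply/negP => l2; have := pM p pp; rewrite leqNgt => /negP; apply.
  apply: (leq_ltn_trans QM); apply: (@leq_trans (p ^ 2)).
    by rewrite -mulnn ltn_mul.
  by apply: leq_pexp2l => //; exact: prime_gt0.
have cE : c = \prod_(p <- primes_in 0 M) p ^ logn p c.
  rewrite {1}(prod_prime_decomp c0) prime_decompE big_map /=.
  rewrite [RHS](bigID (fun p => p \in primes c)) /= [X in _ = _ * X]big1 ?muln1; last first.
    move=> p pc; suff -> : logn p c = 0 by [].
    by apply/eqP; rewrite eqn0Ngt logn_gt0.
  rewrite -[RHS]big_filter; apply: perm_big; apply: uniq_perm.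
  - exact: primes_uniq.
  - by rewrite filter_uniq // primes_in_uniq.
  move=> p; rewrite mem_filter mem_primes_in; case: (boolP (p \in primes c)) => //= pc.
  have lp : 0 < logn p c by rewrite logn_gt0.
  move: pc; rewrite mem_primes => /and3P[pp _ _]; rewrite pp andbT prime_gt0 //=.
  apply/esym; apply: leq_trans (pM p pp).
  by rewrite -{1}[p]expn1 leq_exp2l ?prime_gt1.
have : 2 ^ n <= c by exact: exp2_le_central_bin.
rewrite cE (@primes_in_cat 0 Q M) ?(@primes_in_cat Q X M) //; try lia.
rewrite !big_cat /=.
set N := size _.
have H1 : \prod_(p <- primes_in 0 Q) p ^ logn p c <= M ^ Q.
  apply: (@leq_trans (\prod_(p <- primes_in 0 Q) M)).
    by apply: leq_prod_seq => p; rewrite mem_primes_in => /andP[_]; exact: pM.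
  rewrite prod_const_seq leq_pexp2l //; first lia.
  by rewrite -[X in _ <= X]subn0 size_primes_in_le.
have H2 : \prod_(p <- primes_in Q X) p ^ logn p c <= 2 ^ (2 * X).
  rewrite -expnS; apply: leq_trans (primorial_dyadic _).
  rewrite (@primes_in_cat 0 Q X) // big_cat /=.
  apply: (@leq_trans (\prod_(p <- primes_in Q X) p)).
    by apply: leq_prod_seq => p; rewrite mem_primes_in => /andP[/andP[? _] ?]; exact: pM1.
  rewrite leq_pmull // big_seq; apply: prodn_cond_gt0 => p.
  by rewrite mem_primes_in; lia.
have H3 : \prod_(p <- primes_in X M) p ^ logn p c <= M ^ N.
  apply: (@leq_trans (\prod_(p <- primes_in X M) M)); last by rewrite prod_const_seq.
  by apply: leq_prod_seq => p; rewrite mem_primes_in => /andP[_]; exact: pM.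
move=> /leq_trans/(_ (leq_mul H1 (leq_mul H2 H3))).
rewrite mulnCA -expnD ME -expnM -expnD leq_exp2l //.
rewrite mulnDr.
have : 3 * m.+1 * Q <= X by rewrite XE leq_mul2r m32 orbT.
lia.
Qed.

(** * Pairs of cells rich in primes *)

Definition cell (m s i : nat) : seq nat :=
  primes_in (i * 2 ^ (3 * m - s)) (i.+1 * 2 ^ (3 * m - s)).

(** The scale [(2 ^ (3 * m), 8 * 2 ^ (3 * m)]] consists of the cells with
    [2 ^ s <= i < 8 * 2 ^ s]; a rich cell has at least a fixed proportion of the
    number of primes that the prime number theorem predicts.  The constant 64
    leaves room for discarding all the other cells in [chunk_few_primes]. *)
Definition rich (m s i : nat) : bool :=
  2 ^ (3 * m) <= 64 * 2 ^ s * m.+1 * size (cell m s i).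

(** If the rich cells of a chunk of [2 ^ (s - t)] consecutive cells all lie
    within [2 ^ d] cells of the first one, then their primes lie in one short
    interval, and the cells that are not rich contain few primes by definition.
    The conclusion is that the chunk misses its share of the Chebyshev bound. *)
Lemma chunk_few_primes m r d t u :
  0 < m -> r + d <= 3 * m -> t <= r -> 42 * 2 ^ t * (r + 6) <= 2 ^ r ->
  let s := r + d in let v := u + 2 ^ (s - t) in
  2 ^ s <= u -> v <= 8 * 2 ^ s ->
  (forall i j, u <= i -> i + 2 ^ d <= j -> j < v -> rich m s i -> ~~ rich m s j) ->
  21 * 2 ^ t * m.+1 * \sum_(u <= b < v) size (cell m s b) < 2 ^ (3 * m).
Proof.
move=> m0 sm tr rt s v su v8 norich; set X := 2 ^ (3 * m).
have X0 : 0 < X by rewrite expn_gt0.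
set W := 2 ^ (3 * m - s).
have XW : X = 2 ^ s * W by rewrite /X /W -expnD; congr (2 ^ _); lia.
rewrite (bigID (fun b => rich m s b)) /=.
set A := \sum_(u <= b < v | _) _; set B := \sum_(u <= b < v | _) _.
(* B counts the primes in the cells that are not rich, A those in rich cells. *)
have HB : 64 * 2 ^ t * m.+1 * B <= X.
  rewrite -(@leq_pmul2l (2 ^ (s - t))) ?expn_gt0 //.
  rewrite !mulnA (mulnC _ 64) -(mulnA 64) -expnD subnK ?(leq_trans tr) ?leq_addr //.
  rewrite /B big_distrr /= big_mkcond /=.
  apply: (@leq_trans (\sum_(u <= b < v) X)).
    by apply: leq_sum => b _; case: ifP => //; rewrite /rich -ltnNge => /ltnW.
  by rewrite sum_nat_const_nat /v addKn.
have HA : 2 * (21 * 2 ^ t * m.+1 * A) <= X.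
  have [/hasP[b0 _ /andP[]]|/hasPn none] :=
      boolP (has (fun b => (u <= b < v) && rich m s b) (iota 0 v)); last first.
    rewrite /A big_nat_cond big1 ?muln0 // => b /andP[/andP[ub bv] rb].
    have := none b; rewrite mem_iota /= add0n => /(_ bv).
    by rewrite ub bv rb.
  move=> b0uv rb0.
  have ex : exists b, (u <= b < v) && rich m s b by exists b0; rewrite b0uv.
  case: (ex_minnP ex) => i /andP[/andP[ui iv] ri] imin {b0 b0uv rb0 ex}.
  have AS : A <= \sum_(i <= b < i + 2 ^ d) size (cell m s b).
    rewrite /A (big_cat_nat (n := i)) //=; last exact: ltnW.
    rewrite [X in X + _ <= _]big_nat_cond [X in X + _ <= _]big1 ?add0n; last first.
      move=> b /andP[/andP[ub bi] rb]; have := imin b.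
      by rewrite ub rb (ltn_trans bi iv) /= leqNgt bi => /(_ isT).
    case: (leqP v (i + 2 ^ d)) => [vi|/ltnW vi].
      rewrite [X in _ <= X](big_cat_nat (n := v)) //=; last exact: ltnW.
      rewrite (leq_trans _ (leq_addr _ _)) // big_mkcond.
      by apply: leq_sum => b _; case: ifP.
    rewrite (big_cat_nat (n := i + 2 ^ d)) //=; last exact: leq_addr.
    rewrite [X in _ + X]big_nat_cond [X in _ + X]big1 ?addn0.
      by rewrite big_mkcond; apply: leq_sum => b _; case: ifP.
    move=> b /andP[/andP[ib bv] rb].
    by move: (norich i b ui ib bv ri); rewrite rb.
  have span : 3 * m * A <= (r + 6) * 2 ^ (3 * m - r).
    apply: leq_trans (leq_mul (leqnn _) AS) _.
    rewrite /cell sum_size_primes_in ?leq_addr // mulnDl -/W.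
    have -> : 2 ^ d * W = 2 ^ (3 * m - r).
      by rewrite /W -expnD; congr (2 ^ _); rewrite /s; lia.
    apply: primes_in_short; first lia.
    rewrite -/X XW leq_mul2r (leq_trans su ui) orbT /= mulnA.
    by rewrite ltn_mul2r expn_gt0 /= (leq_trans iv).
  rewrite -(@leq_pmul2l (2 ^ r)) ?expn_gt0 //.
  have XR : X = 2 ^ r * 2 ^ (3 * m - r) by rewrite /X -expnD; congr (2 ^ _); lia.
  apply: (@leq_trans (2 ^ r * (42 * 2 ^ t * (3 * m * A)))).
    rewrite leq_mul2l; apply/orP; right.
    have : m.+1 * A <= 3 * m * A by rewrite leq_mul2r; lia.
    have -> : 2 * (21 * 2 ^ t * m.+1 * A) = 42 * 2 ^ t * (m.+1 * A) by lia.
    by move=> ?; rewrite leq_mul2l; apply/orP; right.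
  rewrite leq_mul2l; apply/orP; right.
  apply: leq_trans (leq_mul (leqnn _) span) _.
  by rewrite mulnA XR leq_mul2r rt orbT.
rewrite mulnDr; move: HA HB.
have -> : 21 * 2 ^ t * m.+1 * A = 21 * (2 ^ t * m.+1 * A) by lia.
have -> : 21 * 2 ^ t * m.+1 * B = 21 * (2 ^ t * m.+1 * B) by lia.
have -> : 64 * 2 ^ t * m.+1 * B = 64 * (2 ^ t * m.+1 * B) by lia.
lia.
Qed.

Lemma sum_chunks (f : nat -> nat) H a b : a <= b ->
  \sum_(a * H <= i < b * H) f i
  = \sum_(a <= c < b) \sum_(c * H <= i < c * H + H) f i.
Proof.
elim: b => [|b IH] ab.
  by move: ab; rewrite leqn0 => /eqP ->; rewrite !big_geq.
move: ab; rewrite leq_eqVlt => /predU1P [->|ab]; first by rewrite !big_geq.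
rewrite big_nat_recr //= -IH // (big_cat_nat (n := b * H)) //=.
- by rewrite (mulSn b) (addnC H).
- by rewrite leq_mul2r -ltnS ab orbT.
- by rewrite leq_mul2r leqnSn orbT.
Qed.

Lemma pow2_dominates t : 42 * 2 ^ t * (2 * t + 12 + 6) <= 2 ^ (2 * t + 12).
Proof.
rewrite expnD mul2n -addnn expnD.
have -> : 2 ^ 12 = 42 * 97 + 22 by [].
have : t < 2 ^ t by rewrite ltn_expl.
move: (2 ^ t) => y ty.
have : y * (t + t + 12 + 6) <= y * (97 * y) by rewrite leq_mul2l; lia.
have : 0 < y by lia.
rewrite -(leq_pmul2l (ltac:(by []) : 0 < 42)); nia.
Qed.

(** If no chunk had two rich cells far apart, adding up [chunk_few_primes] over
    the [7 * 2 ^ t] chunks would contradict Chebyshev's lower bound. *)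
Lemma rich_pair d t : exists s, forall m, s <= m -> exists i j,
  [/\ 2 ^ s <= i, i + 2 ^ d <= j, j < 8 * 2 ^ s, (j - i) * 2 ^ t <= 2 ^ s
    & rich m s i && rich m s j].
Proof.
(* This r makes the bound of primes_in_short, summed over all chunks, smaller
   than the number of primes in the scale. *)
pose r := 2 * t + 12; exists (r + d) => m sm; set s := r + d.
have ts : t <= s by rewrite /s /r; lia.
have sE : 2 ^ s = 2 ^ t * 2 ^ (s - t) by rewrite -expnD subnKC.
pose N := 8 * 2 ^ s.
pose good i j := [&& 2 ^ s <= i, i + 2 ^ d <= j, j < N, (j - i) * 2 ^ t <= 2 ^ s,
    rich m s i & rich m s j].
have [/hasP[i _ /hasP[j _ /and5P[? ? ? ? ?]]]|/hasPn nogood] :=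
    boolP (has (fun i => has (good i) (iota 0 N)) (iota 0 N)); first by exists i, j.
have {}nogood i j : ~~ good i j.
  apply/negP => g; case/and5P: (g) => _ ij jN _ _.
  have iN : i < N by apply: leq_ltn_trans jN; apply: leq_trans ij; exact: leq_addr.
  have := nogood i; rewrite mem_iota iN => /(_ isT)/hasPn/(_ j).
  by rewrite mem_iota jN g => /(_ isT).
exfalso; have := @primes_in_lower m ltac:(rewrite /s /r in sm; lia).
apply/negP; rewrite -ltnNge.
set X := 2 ^ (3 * m); set W := 2 ^ (3 * m - s).
have XW : X = 2 ^ t * 2 ^ (s - t) * W.
  by rewrite -sE /X /W -expnD; congr (2 ^ _); lia.
have -> : primes_in X (8 * X)
    = primes_in (2 ^ t * 2 ^ (s - t) * W) (8 * 2 ^ t * 2 ^ (s - t) * W).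
  by rewrite -XW; congr primes_in; rewrite XW !mulnA.
rewrite -sum_size_primes_in; last by rewrite leq_mul2r leq_pmull ?orbT.
rewrite sum_chunks; last by rewrite leq_pmull.
rewrite -(@ltn_pmul2l (7 * 2 ^ t)) ?muln_gt0 ?expn_gt0 //.
have -> (y : nat) : 7 * 2 ^ t * (3 * m.+1 * y) = 21 * 2 ^ t * m.+1 * y by lia.
rewrite big_distrr /=.
apply: (@leq_ltn_trans (\sum_(2 ^ t <= c < 8 * 2 ^ t) X.-1)); last first.
  rewrite sum_nat_const_nat (_ : 8 * 2 ^ t - 2 ^ t = 7 * 2 ^ t); last lia.
  by rewrite ltn_pmul2l ?muln_gt0 ?expn_gt0 // prednK ?expn_gt0.
rewrite big_nat [X in _ <= X]big_nat; apply: leq_sum => c /andP[c1 c2].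
rewrite -ltnS prednK ?expn_gt0 //.
apply: (@chunk_few_primes m r d t (c * 2 ^ (s - t))).
- by rewrite /s /r in sm; lia.
- by rewrite -/s; lia.
- by rewrite /r; lia.
- exact: pow2_dominates.
- by rewrite -/s sE leq_mul2r c1 orbT.
- by rewrite -/s sE addnC -mulSn mulnA leq_mul2r c2 orbT.
move=> i j ci ij jc ri; apply/negP => rj.
move/negP: (nogood i j); apply; apply/and5P; split=> //.
- by apply: leq_trans ci; rewrite sE leq_mul2r c1 orbT.
- apply: leq_trans jc _; rewrite /N -/s sE addnC -mulSn mulnA leq_mul2r c2 orbT //.
- rewrite sE mulnC leq_mul2l; apply/orP; right; rewrite -/s in jc; lia.
- by rewrite ri.
Qed.

End PrimesInCells.

Lemma harmonic_unbounded (R : realType) (s : nat) (L : R) :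
  exists M, L <= \sum_(s <= m < M) m.+1%:R^-1.
Proof.
apply/not_existsP => small; apply: (@dvg_harmonic R).
apply: nondecreasing_is_cvgn.
  apply/nondecreasing_seqP => n; rewrite /series /= big_nat_recr //=.
  by rewrite lerDl invr_ge0 ler0n.
exists (\sum_(0 <= m < s) m.+1%:R^-1 + L) => _ [n _ <-]; rewrite /series /=.
have sum_ge0 a b : 0 <= \sum_(a <= m < b) (m.+1%:R^-1 : R).
  by apply: sumr_ge0 => m _; rewrite invr_ge0 ler0n.
have [ns|sn] := leqP n s.
  rewrite [X in _ <= X + _](big_cat_nat (n := n)) //= -addrA lerDl.
  rewrite addr_ge0 //; have /negP := small s; rewrite -ltNge big_geq //; lra.
rewrite (big_cat_nat (n := s)) ?(ltnW sn) //= lerD2l.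
by have /negP := small n; rewrite -ltNge => /ltW.
Qed.

(** Pigeonhole: infinitely many scales [m] share finitely many pairs [(i, j)],
    and the harmonic series diverges.  It matters for [mean_dilate_ratio] that
    [s], hence a bound on [i] and [j], is fixed before [L]. *)
Lemma rich_scales (R : realType) (d t : nat) : exists s : nat, forall L : R,
  exists i j (J : seq nat),
  [/\ [/\ (2 ^ s <= i)%N, (i + 2 ^ d <= j)%N, (j < 8 * 2 ^ s)%N
       & ((j - i) * 2 ^ t <= 2 ^ s)%N],
      uniq J,
      {in J, forall m, [/\ (s <= m)%N, rich m s i & rich m s j]}
    & L <= \sum_(m <- J) m.+1%:R^-1].
Proof.
have [s pairs] := rich_pair d t; exists s => L.
set N := (8 * 2 ^ s)%N.
have /choice [col colP] : forall m, exists ij : 'I_N.+1 * 'I_N.+1, (s <= m)%N ->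
    [/\ (2 ^ s <= ij.1)%N, (ij.1 + 2 ^ d <= ij.2)%N, (ij.2 < N)%N,
    ((ij.2 - ij.1) * 2 ^ t <= 2 ^ s)%N & rich m s ij.1 && rich m s ij.2].
  move=> m; have [sm|] := leqP s m; last by exists (ord0, ord0).
  have [i [j [si ij jN ijt rij]]] := pairs m sm.
  by exists (inord i, inord j) => _ /=; rewrite !inordK; try lia; split.
(* The maximum with 1 forces the set J of scales to be nonempty, so that the
   bounds on the chosen pair (i, j) can be read off from one of them. *)
have L1_ge0 : 0 <= Num.max L 1 by rewrite le_max ler01 orbT.
have [M LM] := harmonic_unbounded s (#|{: 'I_N.+1 * 'I_N.+1}|%:R * Num.max L 1).
have [c Lc] : exists c, Num.max L 1 <= \sum_(s <= m < M | col m == c) m.+1%:R^-1.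
  apply/not_existsP => small; move: LM; apply/negP; rewrite -ltNge.
  rewrite (partition_big col xpredT) //= mulr_natl -sumr_const.
  apply: ltr_sum => [|c _]; last by rewrite ltNge; apply/negP; exact: small.
  by apply/hasP; exists (ord0, ord0); rewrite ?mem_index_enum.
set J := [seq m <- index_iota s M | col m == c].
have inJ m : m \in J -> (s <= m)%N /\ col m = c.
  by rewrite mem_filter mem_index_iota => /andP[/eqP -> /andP[]].
have [m0 m0J _] : exists2 m0, m0 \in J & xpredT m0.
  apply/hasP; rewrite has_predT lt0n size_eq0; apply: contraTneq Lc => J0.
  by rewrite -big_filter -/J J0 big_nil -ltNge lt_max ltr01 orbT.
have [sm0 cm0] := inJ _ m0J.
have := colP _ sm0; rewrite cm0 => -[? ? ? ? _].
exists c.1, c.2, J; split=> //.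
- by rewrite filter_uniq // iota_uniq.
- by move=> m /inJ[sm cm]; have := colP _ sm; rewrite cm => -[_ _ _ _ /andP[]].
- by rewrite big_filter; apply: le_trans Lc; rewrite le_max lexx.
Qed.

(** * The Turan-Kubilius inequality and means over Omega *)

Lemma prime_Omega_mul p n : prime p -> (0 < n)%N ->
  prime_Omega (p * n) = (prime_Omega n).+1.
Proof.
move=> pp n0; have p0 := prime_gt0 pp; have pn0 : (0 < p * n)%N by rewrite muln_gt0 p0.
have -> : prime_Omega n = (\sum_(q <- primes (p * n)) logn q n)%N.
  rewrite [RHS](bigID (fun q => q \in primes n)) /= [X in _ = (_ + X)%N]big1 ?addn0; last first.
    by move=> q qn; apply/eqP; rewrite eqn0Ngt logn_gt0.
  rewrite -[RHS]big_filter; apply: perm_big; apply: uniq_perm; first exact: primes_uniq.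
    by rewrite filter_uniq // primes_uniq.
  by move=> q; rewrite mem_filter primesM //; case: (q \in primes n); rewrite ?orbT.
rewrite /prime_Omega -addn1 addnC.
have {1}-> : 1%N = (\sum_(q <- primes (p * n)) logn q p)%N.
  rewrite (bigD1_seq p) ?primes_uniq //=; last first.
    by rewrite mem_primes pp pn0 dvdn_mulr.
  rewrite logn_prime // eqxx big1_seq // => q /andP[/negPf qp].
  by rewrite logn_prime // qp.
by rewrite -big_split; apply: eq_bigr => q _; rewrite lognM.
Qed.

Lemma sum_multiples (V : nmodType) (d X : nat) (f : nat -> V) : (0 < d)%N ->
  \sum_(1 <= n < X.+1 | (d %| n)%N) f n = \sum_(1 <= n < (X %/ d).+1) f (d * n)%N.
Proof.
move=> d0; elim: X => [|X IH]; first by rewrite div0n !big_geq.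
rewrite big_mkcond big_nat_recr //= -big_mkcond /= IH divnS //.
case: ifP => [dX|_]; last by rewrite add0n addr0.
rewrite add1n [RHS]big_nat_recr //=; congr (_ + f _).
by apply/esym; rewrite mulnC -[RHS](divnK dX) divnS // dX.
Qed.

(** Under a random [n] its expectation is close to [\sum_(p <- B) c p]. *)
Definition divisor_sum (R : realType) (B : seq nat) (c : nat -> R) (n : nat) : R :=
  \sum_(p <- B) c p * p%:R * (p %| n)%N%:R.

(** The events [p %| n] for distinct primes are nearly independent, so only the
    diagonal terms [c p ^+ 2 * p] survive; the second summand comes from rounding
    in [X %/ p]. *)
Lemma divisor_sum_variance (R : realType) (B : seq nat) (c : nat -> R) (X : nat)
    (C := \sum_(p <- B) c p) :
  uniq B -> {in B, forall p, prime p} -> (forall p, 0 <= c p) ->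
  \sum_(1 <= n < X.+1) (divisor_sum B c n - C) ^+ 2
  <= X%:R * \sum_(p <- B) c p ^+ 2 * p%:R + 2 * C * \sum_(p <- B) c p * p%:R.
Proof.
move=> uB prB c_ge0; have C_ge0 : 0 <= C by exact: sumr_ge0.
have count_dvd d : \sum_(1 <= n < X.+1) (d %| n)%:R = (X %/ d)%:R :> R.
  by rewrite divn_count_dvd natr_sum.
have sumS : C * X%:R - \sum_(p <- B) c p * p%:R
    <= \sum_(1 <= n < X.+1) divisor_sum B c n.
  rewrite /divisor_sum exchange_big /= mulr_suml -sumrB big_seq [leRHS]big_seq.
  apply: ler_sum => p pB.
  rewrite -mulr_sumr count_dvd -mulrBr -mulrA ler_wpM2l //.
  rewrite lerBlDr -natrM -natrD ler_nat {1}(divn_eq X p) mulnC leq_add2l.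
  by rewrite ltnW // ltn_mod prime_gt0 // prB.
have sumS2 : \sum_(1 <= n < X.+1) divisor_sum B c n ^+ 2
    <= C ^+ 2 * X%:R + X%:R * \sum_(p <- B) c p ^+ 2 * p%:R.
  have -> : C ^+ 2 * X%:R + X%:R * \sum_(p <- B) c p ^+ 2 * p%:R
     = \sum_(p <- B) \sum_(q <- B) (c p * c q * X%:R + (q == p)%:R * (c p ^+ 2 * p%:R * X%:R)).
    rewrite [RHS](eq_bigr (fun p => \sum_(q <- B) c p * c q * X%:R
        + \sum_(q <- B) (q == p)%:R * (c p ^+ 2 * p%:R * X%:R))); last first.
      by move=> p _; rewrite big_split.
    rewrite big_split /=; congr (_ + _).
      rewrite expr2 /C !mulr_suml; apply: eq_bigr => p _.
      by rewrite mulr_sumr mulr_suml.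
    rewrite mulrC mulr_suml big_seq [RHS]big_seq; apply: eq_bigr => p pB.
    rewrite (bigD1_seq p) //= eqxx mul1r big1 ?addr0 // => q /negPf ->.
    by rewrite mul0r.
  under eq_bigr => n _ do rewrite expr2 /divisor_sum mulr_suml.
  rewrite exchange_big /= big_seq [leRHS]big_seq; apply: ler_sum => p pB.
  under eq_bigr => n _ do rewrite mulr_sumr.
  rewrite exchange_big /= big_seq [leRHS]big_seq; apply: ler_sum => q qB.
  have p0 := prime_gt0 (prB _ pB); have q0 := prime_gt0 (prB _ qB).
  have -> : \sum_(1 <= n < X.+1) c p * p%:R * (p %| n)%N%:R * (c q * q%:R * (q %| n)%N%:R)
     = c p * c q * (p * q)%:R * \sum_(1 <= n < X.+1) ((p %| n)%N && (q %| n)%N)%:R.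
    rewrite mulr_sumr; apply: eq_bigr => n _; rewrite natrM -mulnb natrM; ring.
  have [->|qp] := eqVneq q p.
    under eq_bigr => n _ do rewrite andbb.
    rewrite count_dvd mul1r expr2 -[leLHS]addr0 addrC lerD //.
      by rewrite !mulr_ge0.
    rewrite -!mulrA !ler_wpM2l // natrM -mulrA ler_wpM2l //.
    by rewrite -natrM ler_nat mulnC leq_divM.
  have cpq : coprime p q.
    by rewrite prime_coprime ?dvdn_prime2 ?prB // eq_sym.
  under eq_bigr => n _ do rewrite -Gauss_dvd //.
  rewrite count_dvd mul0r addr0 -!mulrA !ler_wpM2l //.
  by rewrite -natrM ler_nat mulnC leq_divM.
have -> : \sum_(1 <= n < X.+1) (divisor_sum B c n - C) ^+ 2
   = \sum_(1 <= n < X.+1) divisor_sum B c n ^+ 2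
     - 2 * C * \sum_(1 <= n < X.+1) divisor_sum B c n + C ^+ 2 * X%:R.
  have -> : C ^+ 2 * X%:R = \sum_(1 <= n < X.+1) C ^+ 2.
    by rewrite sumr_const_nat subn1 mulr_natr.
  rewrite mulr_sumr -sumrB -big_split /=; apply: eq_bigr => n _; ring.
have : 2 * C * (C * X%:R - \sum_(p <- B) c p * p%:R)
    <= 2 * C * \sum_(1 <= n < X.+1) divisor_sum B c n by rewrite ler_wpM2l // mulr_ge0.
rewrite mulrBr; move: sumS2; rewrite expr2; lra.
Qed.

Definition mean (R : realType) (g : nat -> R) (x : R) : R :=
  x^-1 * \sum_(1 <= n < (Num.truncn x).+1) g (prime_Omega n).

Lemma truncn_div_nat (R : realType) (x : R) p : 0 <= x -> (0 < p)%N ->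
  Num.truncn (x / p%:R) = (Num.truncn x %/ p)%N.
Proof.
move=> x0 p0; have p0' : 0 < p%:R :> R by rewrite ltr0n.
have /andP[x1 x2] := truncn_itv x0.
apply/eqP; rewrite truncn_eq ?divr_ge0 ?ler0n // ler_pdivlMr // ltr_pdivrMr //.
rewrite -!natrM (le_trans _ x1) ?ler_nat ?leq_divM //=.
by rewrite (lt_le_trans x2) // ler_nat ltn_ceil.
Qed.

(** The difference is the mean of [g (prime_Omega n) * (1 - divisor_sum B c n)],
    which is small since the second factor is small in mean square.  The
    threshold for [x] depends on the weights, but not on [g]. *)
Lemma turan_kubilius_mean (R : realType) (B : seq nat) (c : nat -> R) (e : R) :
  uniq B -> {in B, forall p, prime p} -> (forall p, 0 <= c p) ->
  \sum_(p <- B) c p = 1 -> 0 < e ->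
  \sum_(p <- B) c p ^+ 2 * p%:R <= e ^+ 2 / 2 ->
  exists x0 : R, forall x, x0 <= x -> forall g, (forall k, `|g k| <= 1) ->
    `|mean g x - \sum_(p <- B) c p * mean (g \o succn) (x / p%:R)| <= e.
Proof.
move=> uB prB c_ge0 c1 e0 small; set V := \sum_(p <- B) c p * p%:R.
exists (1 + 4 * V / e ^+ 2) => x xV g g1.
have V0 : 0 <= V by apply: sumr_ge0 => p _; rewrite mulr_ge0.
have x0 : 0 < x.
  apply: lt_le_trans xV; rewrite ltr_wpDr //.
  by apply: divr_ge0; [exact: mulr_ge0 | exact/exprn_ge0/ltW].
set X := Num.truncn x.
have Xx : X%:R <= x by rewrite truncn_le ltW.
have -> : mean g x - \sum_(p <- B) c p * mean (g \o succn) (x / p%:R)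
    = x^-1 * \sum_(1 <= n < X.+1) g (prime_Omega n) * (1 - divisor_sum B c n).
  rewrite /mean -/X.
  under [X in _ = _ * X]eq_bigr => n _ do rewrite mulrBr mulr1.
  rewrite sumrB mulrBr; congr (_ - _).
  under [X in _ * X]eq_bigr => n _ do rewrite /divisor_sum mulr_sumr.
  rewrite exchange_big /= mulr_sumr big_seq [RHS]big_seq; apply: eq_bigr => p pB.
  have p0 := prime_gt0 (prB _ pB).
  rewrite truncn_div_nat ?ltW // -/X invf_div !mulrA (mulrC _ x^-1) -!mulrA.
  congr (_ * _); rewrite !mulrA.
  rewrite [RHS](eq_bigr (fun n =>
      if (p %| n)%N then g (prime_Omega n) * (c p * p%:R) else 0)); last first.
    by move=> n _; case: (p %| n)%N; rewrite ?mulr1 ?mulr0.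
  rewrite -big_mkcond sum_multiples //= mulr_sumr.
  rewrite [LHS]big_nat [RHS]big_nat; apply: eq_bigr => n /andP[n0 _].
  by rewrite prime_Omega_mul ?prB // [RHS]mulrC.
rewrite normrM gtr0_norm ?invr_gt0 // ler_pdivrMl // (le_trans (ler_norm_sum _ _ _)) //.
set C := \sum_(p <- B) c p in c1.
(* |z| <= e / 2 + z ^ 2 / (2 e) takes the place of the Cauchy-Schwarz inequality. *)
apply: (@le_trans _ _ (\sum_(1 <= n < X.+1) (e / 2 + (divisor_sum B c n - C) ^+ 2 / e / 2))).
  apply: ler_sum => n _; rewrite normrM c1.
  apply: (@le_trans _ _ `|1 - divisor_sum B c n|); first by rewrite ler_piMl.
  rewrite distrC -real_normK ?num_real //; set z := `|_|.
  rewrite -(ler_pM2r e0) mulrDl -!mulrA (mulrCA e^-1) mulVf ?gt_eqF // mulr1.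
  have := sqr_ge0 (z - e); nra.
rewrite big_split /= sumr_const_nat subn1 -!mulr_suml -(mulr_natl (e / 2)).
have := divisor_sum_variance X uB prB c_ge0; rewrite -/V -/C c1 mulr1.
set S := \sum_(1 <= n < _) _ => SV.
rewrite -(ler_pM2r e0).
have H1 : X%:R * \sum_(p <- B) c p ^+ 2 * p%:R <= x * (e ^+ 2 / 2).
  by rewrite ler_pM // ?ler0n // sumr_ge0 // => p _; rewrite mulr_ge0 ?sqr_ge0.
have e2 : 0 < e ^+ 2 by rewrite exprn_gt0.
have H2 : 4 * V <= e ^+ 2 * x.
  by rewrite -ler_pdivrMl // mulrC (le_trans _ xV) // lerDr.
have H3 : X%:R * e ^+ 2 <= x * e ^+ 2 by rewrite ler_pM2r.
rewrite expr2 in H1 H2 H3.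
have -> : (X%:R * (e / 2) + S / e / 2) * e = X%:R * (e * e) / 2 + S / 2.
  by field; rewrite gt_eqF.
have -> : x * e * e = e * e * x by ring.
lra.
Qed.

(** The mean is a slowly varying function of the logarithm of [x]; the term
    [x^-1] accounts for integer parts. *)
Lemma mean_lipschitz (R : realType) (g : nat -> R) (x y : R) :
  (forall k, `|g k| <= 1) -> 0 < y -> y <= x ->
  `|mean g x - mean g y| <= 2 * (1 - y / x) + x^-1.
Proof.
move=> g1 y0 yx; have x0 : 0 < x by exact: lt_le_trans yx.
rewrite /mean; set X := Num.truncn x; set Y := Num.truncn y.
have YX : (Y <= X)%N by exact: le_truncn.
have sum_le a b : (a <= b)%N ->
    `|\sum_(a.+1 <= n < b.+1) g (prime_Omega n)| <= b%:R - a%:R.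
  move=> ab; apply: le_trans (ler_norm_sum _ _ _) _.
  rewrite -natrB // -[leRHS]mulr1 -subSS mulr_natl -sumr_const_nat.
  exact: ler_sum.
rewrite (@big_cat_nat _ _ _ Y.+1) //= ?ltnS //.
have := sum_le _ _ YX; have := sum_le 0%N Y (leq0n _); rewrite subr0.
set A := \sum_(_ <= _ < _) _; set D := \sum_(_ <= _ < _) _ => HA HD.
have -> : x^-1 * (A + D) - y^-1 * A = x^-1 * D - A * (y^-1 - x^-1) by ring.
apply: le_trans (ler_normB _ _) _.
have yx' : 0 <= y^-1 - x^-1 by rewrite subr_ge0 lef_pV2.
have Yy : Y%:R <= y by rewrite truncn_le ltW.
have Xx : X%:R <= x by rewrite truncn_le ltW.
have Yy1 : y < Y%:R + 1 by rewrite natr1 truncnS_gt.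
rewrite !normrM (ger0_norm yx') gtr0_norm ?invr_gt0 //.
have -> : 2 * (1 - y / x) + x^-1 = x^-1 * (x - y + 1) + y * (y^-1 - x^-1).
  by field; rewrite !gt_eqF.
apply: lerD.
  rewrite ler_pM2l ?invr_gt0 //; lra.
rewrite ler_wpM2r //; lra.
Qed.

(** * Averages over rich cells *)

Lemma cell_bounds m s i p : p \in cell m s i ->
  [/\ prime p, (i * 2 ^ (3 * m - s) < p)%N & (p <= i.+1 * 2 ^ (3 * m - s))%N].
Proof. by rewrite mem_primes_in => /andP[/andP[? ?] ?]. Qed.

Lemma cell_scale m s i p : (s <= m)%N -> (2 ^ s <= i < 8 * 2 ^ s)%N ->
  p \in cell m s i -> (p <= 8 * 2 ^ (3 * m))%N /\ trunc_log 8 p.-1 = m.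
Proof.
move=> sm /andP[si i8] /cell_bounds[pp p1 p2].
have XE : (2 ^ (3 * m) = 2 ^ s * 2 ^ (3 * m - s))%N by rewrite -expnD; congr expn; lia.
have p8 : (p <= 8 * 2 ^ (3 * m))%N.
  by rewrite (leq_trans p2) // XE mulnA leq_mul2r i8 orbT.
split=> //; apply: trunc_log_eq => //.
have E8 k : (8 ^ k = 2 ^ (3 * k))%N by rewrite (_ : 8 = 2 ^ 3)%N // -expnM.
have Xp : (2 ^ (3 * m) < p)%N.
  by apply: leq_ltn_trans p1; rewrite XE leq_mul2r si orbT.
by rewrite !E8 mulnS expnD; apply/andP; split; lia.
Qed.

(** The Turan-Kubilius inequality for the primes of cell [i] in the scales [J],
    where scale [m] gets weight proportional to [1 / m.+1], shared equally by
    its primes.  Richness makes the variance at most a constant over [Lam].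
    All primes of a cell agree up to a factor [1 + 1 / i], hence may be replaced
    by the left end of the cell at the cost [3 / i]. *)
Lemma rich_average (R : realType) (s i : nat) (J : seq nat) (e : R)
    (Lam := \sum_(m <- J) m.+1%:R^-1 : R) :
  (2 ^ s <= i < 8 * 2 ^ s)%N -> uniq J ->
  {in J, forall m, (s <= m)%N /\ rich m s i} ->
  0 < e -> (2 ^ (s + 10))%:R <= e ^+ 2 * Lam ->
  exists x0 : R, forall x, x0 <= x -> forall g, (forall k, `|g k| <= 1) ->
  `|mean g x - \sum_(m <- J) (Lam * m.+1%:R)^-1
       * mean (g \o succn) (x / (i * 2 ^ (3 * m - s))%:R)| <= e + 3 / i%:R.
Proof.
move=> si uJ rJ e0 bigLam.
have i0 : (0 < i)%N by case/andP: si => si _; apply: leq_trans si; rewrite expn_gt0.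
pose K : R := (2 ^ (s + 9))%:R.
have KE : (2 ^ (s + 10))%:R = 2 * K by rewrite -natrM -expnS addnS.
rewrite KE in bigLam.
have Lam0 : 0 < Lam.
  have : 0 < e ^+ 2 * Lam by apply: lt_le_trans bigLam; rewrite mulr_gt0 // ltr0n expn_gt0.
  by rewrite pmulr_rgt0 // exprn_gt0.
pose B := [seq p | m <- J, p <- cell m s i].
(* The scale of a prime p of B is recovered as the base 8 logarithm of p - 1. *)
pose c p : R := (Lam * (trunc_log 8 p.-1).+1%:R
                  * (size (cell (trunc_log 8 p.-1) s i))%:R)^-1.
have n_gt0 m : m \in J -> (0 < size (cell m s i))%N.
  move=> /rJ[_]; rewrite /rich lt0n; apply: contraTneq => ->.
  by rewrite muln0 -ltnNge expn_gt0.
have cE m p : m \in J -> p \in cell m s i ->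
    c p = (Lam * m.+1%:R)^-1 / (size (cell m s i))%:R.
  by move=> /rJ[sm _] /(cell_scale sm si)[_ pm]; rewrite /c pm invfM.
have uB : uniq B.
  apply: allpairs_uniq_dep => //.
    by move=> m _; exact: primes_in_uniq.
  move=> _ _ /allpairsPdep[m [p [mJ pm ->]]] /allpairsPdep[m' [p' [mJ' pm' ->]]] /= pp'.
  have [sm _] := rJ _ mJ; have [sm' _] := rJ _ mJ'.
  have [_ <-] := cell_scale sm si pm; have [_ <-] := cell_scale sm' si pm'.
  by rewrite pp'.
have prB : {in B, forall p, prime p}.
  by move=> _ /allpairsPdep[m [p [mJ pm ->]]]; have [] := cell_bounds pm.
have c_ge0 p : 0 <= c p by rewrite invr_ge0 !mulr_ge0 // ltW.
have sumB (G : nat -> R) : \sum_(p <- B) c p * G p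
   = \sum_(m <- J) (Lam * m.+1%:R)^-1
        * (\sum_(p <- cell m s i) G p / (size (cell m s i))%:R).
  rewrite big_allpairs_dep big_seq [RHS]big_seq; apply: eq_bigr => m mJ.
  rewrite mulr_sumr big_seq [RHS]big_seq; apply: eq_bigr => p pm.
  by rewrite (cE m) // -mulrA [_ / _]mulrC.
have cell_avg m (a : R) : m \in J ->
    \sum_(p <- cell m s i) a / (size (cell m s i))%:R = a.
  move=> mJ; rewrite big_const_seq count_predT iter_addr_0 -(mulr_natr (a / _)) divfK //.
  by rewrite pnatr_eq0 -lt0n n_gt0.
have w_sum : \sum_(m <- J) (Lam * m.+1%:R)^-1 = 1.
  under eq_bigr => m _ do rewrite invfM.
  by rewrite -mulr_sumr mulVf ?gt_eqF.
have sum_c1 : \sum_(p <- B) c p = 1.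
  under eq_bigr => p _ do rewrite -[c p]mulr1.
  rewrite sumB -[RHS]w_sum big_seq [RHS]big_seq; apply: eq_bigr => m mJ.
  by rewrite cell_avg // mulr1.
have sum_c2 : \sum_(p <- B) c p ^+ 2 * p%:R <= e ^+ 2 / 2.
  under eq_bigr => p _ do rewrite expr2 -mulrA.
  rewrite sumB.
  apply: (@le_trans _ _ (\sum_(m <- J) m.+1%:R^-1 * (K / Lam ^+ 2))).
    rewrite big_seq [leRHS]big_seq; apply: ler_sum => m mJ.
    have [sm rm] := rJ _ mJ.
    have m0 : 0 < m.+1%:R :> R by [].
    rewrite (_ : m.+1%:R^-1 * _ = (Lam * m.+1%:R)^-1 * (K / Lam)); last first.
      by move: m.+1%:R m0 => y y0; field; rewrite !gt_eqF.
    rewrite ler_wpM2l //; first by rewrite invr_ge0 ltW // mulr_gt0.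
    rewrite -[leRHS](cell_avg m) // big_seq [leRHS]big_seq; apply: ler_sum => p pm.
    have n0 := n_gt0 _ mJ.
    rewrite ler_wpM2r ?invr_ge0 //.
    have [p8 _] := cell_scale sm si pm.
    rewrite (cE m) //; set n := size _ in n0 *.
    have n0' : 0 < n%:R :> R by rewrite ltr0n.
    have -> : (Lam * m.+1%:R)^-1 / n%:R * p%:R = p%:R / (m.+1%:R * n%:R) / Lam.
      by move: m.+1%:R m0 => y y0; field; rewrite !gt_eqF.
    rewrite ler_wpM2r ?invr_ge0 ?(ltW Lam0) // ler_pdivrMr ?mulr_gt0 //.
    rewrite /K -!natrM ler_nat.
    apply: leq_trans p8 _; rewrite expnD (_ : 2 ^ 9 = 8 * 64)%N //.
    rewrite (mulnC (2 ^ s)%N) -2!(mulnA 8%N) leq_mul2l /=.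
    by move: rm; rewrite /rich -/n -!mulnA.
  rewrite -mulr_suml -/Lam (_ : Lam * (K / Lam ^+ 2) = K / Lam); last first.
    by field; rewrite gt_eqF.
  rewrite ler_pdivrMr //; move: bigLam; lra.
have [x1 Hx1] := turan_kubilius_mean uB prB c_ge0 sum_c1 e0 sum_c2.
(* The second bound makes the rounding term of mean_lipschitz at most 1 / i. *)
exists (Num.max x1 (i ^ 2 * \sum_(m <- J) 2 ^ (3 * m - s))%N%:R) => x.
rewrite ge_max => /andP[xx1 xi] g g1.
have := Hx1 x xx1 g g1; rewrite sumB.
set S1 := \sum_(_ <- _) _; set S2 := \sum_(_ <- _) _ => H1.
suff H2 : `|S1 - S2| <= 3 / i%:R.
  have -> : mean g x - S2 = (mean g x - S1) + (S1 - S2) by ring.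
  by apply: le_trans (ler_normD _ _) _; apply: lerD.
have -> : 3 / i%:R = \sum_(m <- J) (Lam * m.+1%:R)^-1 * (3 / i%:R).
  by rewrite -mulr_suml w_sum mul1r.
rewrite /S1 /S2 -sumrB.
apply: le_trans (ler_norm_sum _ _ _) _.
rewrite big_seq [leRHS]big_seq; apply: ler_sum => m mJ.
have w0 : 0 <= (Lam * m.+1%:R)^-1 by rewrite invr_ge0 mulr_ge0 // ltW.
rewrite -mulrBr normrM (ger0_norm w0) ler_wpM2l //.
rewrite -{1}(cell_avg m (mean _ _) mJ) -sumrB -(cell_avg m (3 / i%:R) mJ).
apply: le_trans (ler_norm_sum _ _ _) _.
rewrite big_seq [leRHS]big_seq; apply: ler_sum => p pm.
rewrite -mulrBl normrM [`|_^-1|]ger0_norm ?invr_ge0 // ler_wpM2r ?invr_ge0 //.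
have [pp p1 p2] := cell_bounds pm.
set W := (2 ^ (3 * m - s))%N in p1 p2 *.
have W0 : (0 < W)%N by rewrite expn_gt0.
have iW0 : 0 < (i * W)%:R :> R by rewrite ltr0n muln_gt0 i0.
have p0 : 0 < p%:R :> R by rewrite ltr0n prime_gt0.
have i0' : 0 < i%:R :> R by rewrite ltr0n.
have xW : (i * (i * W))%:R <= x.
  apply: le_trans xi; rewrite ler_nat mulnA -mulnn leq_mul2l; apply/orP; right.
  by rewrite (bigD1_seq m) //= leq_addr.
have x0 : 0 < x by apply: lt_le_trans xW; rewrite natrM mulr_gt0.
rewrite distrC.
have := @mean_lipschitz _ (g \o succn) (x / (i * W)%:R) (x / p%:R).
move=> /(_ (fun k => g1 k.+1) (divr_gt0 x0 p0)).
rewrite ler_pM2l // lef_pV2 ?posrE // ler_nat ltnW // => /(_ isT) /le_trans; apply.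
have -> : x / p%:R / (x / (i * W)%:R) = (i * W)%:R / p%:R.
  by move: (i * W)%:R p%:R iW0 p0 => y z y0 z0; field; rewrite !gt_eqF.
have -> : 3 / i%:R = 2 / i%:R + i%:R^-1 :> R by ring.
rewrite lerD //.
  rewrite ler_wpM2l // -(ler_pM2r p0) mulrBl mul1r divfK ?gt_eqF //.
  apply: (@le_trans _ _ W%:R); first by rewrite lerBlDl -natrD ler_nat addnC -mulSn.
  by rewrite mulrC ler_pdivlMr // -natrM ler_nat mulnC ltnW.
by rewrite invf_div ler_pdivrMr // ler_pdivlMl // -natrM.
Qed.

(** * Invariance of the means under dilation and shift *)

(** Cells [i] and [j] of the same scale have left ends in the exact ratio
    [j / i], so that [rich_average] at [x] with [i] and at [x * (j / i)] with [j]
    yields the same sum.  The gain over [mean_lipschitz] is that the error is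
    of order [1 / i], while [j / i - 1] is at least [2 ^ d / i]. *)
Lemma mean_dilate_ratio (R : realType) (d t : nat) : exists (i j : nat) (x0 : R),
  [/\ (2 ^ t <= i)%N, (i + 2 ^ d <= j)%N, ((j - i) * 2 ^ t <= i)%N
    & forall x, x0 <= x -> forall g, (forall k, `|g k| <= 1) ->
      `|mean g (x * (j%:R / i%:R)) - mean g x| <= 8 / i%:R].
Proof.
have [s scales] := rich_scales R d t.
pose N := (8 * 2 ^ s)%N.
(* N bounds i, so this value of Lam allows the precision e = 1 / i below. *)
have [i [j [J [[si ij jN ijt] uJ rJ LJ]]]] := scales ((2 ^ (s + 10))%:R * N%:R ^+ 2).
have d0 : (0 < 2 ^ d)%N by rewrite expn_gt0.
have i0 : (0 < i)%N by apply: leq_trans si; rewrite expn_gt0.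
have ltij : (i < j)%N by apply: leq_trans ij; rewrite -[ltnLHS]addn0 ltn_add2l.
have j0 : (0 < j)%N by exact: leq_trans ltij.
have iN' : (i < N)%N by exact: ltn_trans jN.
have sj : (2 ^ s <= j)%N by apply: leq_trans si (ltnW ltij).
have ti : (2 ^ t <= (j - i) * 2 ^ t)%N by rewrite leq_pmull // subn_gt0.
have i0' : 0 < i%:R :> R by rewrite ltr0n.
have j0' : 0 < j%:R :> R by rewrite ltr0n.
have e0 : 0 < i%:R^-1 :> R by rewrite invr_gt0.
have bigLam : (2 ^ (s + 10))%:R <= i%:R^-1 ^+ 2 * \sum_(m <- J) (m.+1%:R^-1 : R).
  rewrite exprVn ler_pdivlMl ?exprn_gt0 // mulrC (le_trans _ LJ) //.
  rewrite ler_wpM2l // ler_pXn2r ?nnegrE // ler_nat.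
  exact: ltnW.
have iN : (2 ^ s <= i < 8 * 2 ^ s)%N by rewrite si.
have jN' : (2 ^ s <= j < 8 * 2 ^ s)%N by rewrite sj.
have rJi : {in J, forall m, (s <= m)%N /\ rich m s i} by move=> m /rJ[].
have rJj : {in J, forall m, (s <= m)%N /\ rich m s j} by move=> m /rJ[].
have [x1 Hi] := rich_average iN uJ rJi e0 bigLam.
have [x2 Hj] := rich_average jN' uJ rJj e0 bigLam.
exists i, j, (Num.max (Num.max x1 x2) 0); split=> //.
- exact: leq_trans ti (leq_trans ijt si).
- exact: leq_trans ijt si.
move=> x; rewrite !ge_max => /andP[/andP[xx1 xx2] x0] g g1.
have ij1 : 1 <= j%:R / i%:R :> R by rewrite ler_pdivlMr // mul1r ler_nat ltnW.
have := Hj (x * (j%:R / i%:R)) _ g g1.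
rewrite (le_trans xx2) ?ler_peMr // => /(_ isT).
have -> : \sum_(m <- J) ((\sum_(m0 <- J) m0.+1%:R^-1) * m.+1%:R)^-1 *
    mean (g \o succn) (x * (j%:R / i%:R) / (j * 2 ^ (3 * m - s))%:R)
  = \sum_(m <- J) ((\sum_(m0 <- J) m0.+1%:R^-1) * m.+1%:R)^-1 *
    mean (g \o succn) (x / (i * 2 ^ (3 * m - s))%:R).
  apply: eq_bigr => m _; congr (_ * mean _ _).
  rewrite !natrM; have : 0 < (2 ^ (3 * m - s))%:R :> R by rewrite ltr0n expn_gt0.
  by move: (2 ^ _)%:R => W W0; field; rewrite !gt_eqF.
have := Hi x xx1 g g1.
set S := \sum_(_ <- _) _; move: (mean g x) (mean g (x * _)) => a b Ha Hb.
have Hji : j%:R^-1 <= i%:R^-1 :> R by rewrite lef_pV2 ?posrE // ler_nat ltnW.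
rewrite (_ : b - a = (b - S) - (a - S)); last by ring.
apply: le_trans (ler_normB _ _) _; apply: le_trans (lerD Hb Ha) _; lra.
Qed.

Lemma bernoulli_le (R : realType) (h : R) n : 0 <= h -> 1 + n%:R * h <= (1 + h) ^+ n.
Proof.
move=> h0; elim: n => [|n IH]; first by rewrite mul0r addr0 expr0.
rewrite exprS; apply: le_trans (ler_wpM2l _ IH); last by rewrite addr_ge0.
have : 0 <= n%:R * h * h by rewrite !mulr_ge0.
by rewrite -natr1; nra.
Qed.

(** Reach [x * y] from [x] by steps of ratio [1 + h].  Since [h >= 2 ^ d / i],
    there are at most [y * i / 2 ^ d] steps of cost [8 / i] each, and the
    remaining factor below [1 + h] is absorbed by [mean_lipschitz]. *)
Lemma mean_dilate (R : realType) (Y e : R) : 0 < e ->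
  exists x0 : R, forall x, x0 <= x -> forall y, 1 <= y <= Y ->
    forall g, (forall k, `|g k| <= 1) -> `|mean g (x * y) - mean g x| <= e.
Proof.
move=> e0.
have pow_gt (z : R) : exists n, z < 2 ^+ n.
  exists (Num.bound z); exact: upper_nthrootP.
(* d controls the accumulated cost of the steps, t the size of one step. *)
have [d Hd] := pow_gt (24 * Y / e); have [t Ht] := pow_gt (6 / e).
have [i [j [x1 [ti ij ijt step]]]] := mean_dilate_ratio R d t.
have i0 : (0 < i)%N by apply: leq_trans ti; rewrite expn_gt0.
have i0' : 0 < i%:R :> R by rewrite ltr0n.
have leij : (i <= j)%N by apply: leq_trans ij; exact: leq_addr.
have dij : (2 ^ d <= j - i)%N by rewrite leq_subRL.
set h : R := (j - i)%:R / i%:R.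
have hE : j%:R / i%:R = 1 + h.
  by rewrite /h natrB //; field; rewrite gt_eqF.
have h_ge : 2 ^+ d / i%:R <= h.
  by rewrite ler_pM2r ?invr_gt0 // -natrX ler_nat.
have h_gt0 : 0 < h by apply: lt_le_trans h_ge; rewrite divr_gt0 // exprn_gt0.
have h_le : h <= 2 ^- t.
  rewrite ler_pdivrMr // ler_pdivlMl ?exprn_gt0 // mulrC -natrX -natrM ler_nat //.
rewrite hE in step.
have iter x k : x1 <= x -> 0 <= x -> forall g, (forall k, `|g k| <= 1) ->
    `|mean g (x * (1 + h) ^+ k) - mean g x| <= k%:R * (8 / i%:R).
  move=> xx1 x0 g g1; elim: k => [|k IH].
    by rewrite expr0 mulr1 subrr normr0 mul0r.
  rewrite exprSr (mulrA x) -natr1 mulrDl mul1r [leRHS]addrC.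
  have hk : 1 <= (1 + h) ^+ k by rewrite exprn_ege1 // lerDl ltW.
  apply: le_trans (ler_distD (mean g (x * (1 + h) ^+ k)) _ _) _.
  by apply: lerD IH; apply: step => //; exact: le_trans xx1 (ler_peMr x0 hk).
exists (Num.max x1 (3 / e)) => x; rewrite ge_max => /andP[xx1 xe] y /andP[y1 yY] g g1.
have x0 : 0 < x by apply: lt_le_trans xe; rewrite divr_gt0.
have y0 : 0 < y by apply: lt_le_trans y1.
have exk : exists k, y < (1 + h) ^+ k.
  exists (Num.bound (y / h)); apply: lt_le_trans (bernoulli_le _ (ltW h_gt0)).
  have : y / h < (Num.bound (y / h))%:R by rewrite archi_boundP // divr_ge0 // ltW.
  rewrite ltr_pdivrMr //; lra.
case: (ex_minnP exk) => -[|k]; first by rewrite expr0 ltNge y1.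
move=> yk1 kmin.
have ky : (1 + h) ^+ k <= y.
  by rewrite leNgt; apply/negP => /kmin; rewrite ltnn.
have Hk := iter x k xx1 (ltW x0) g g1.
(* By Bernoulli's inequality k * h <= (1 + h) ^ k <= Y. *)
have H1 : k%:R * (8 / i%:R) <= e / 3.
  have kY : k%:R * (2 ^+ d / i%:R) <= Y.
    apply: le_trans yY; apply: le_trans ky.
    apply: le_trans (bernoulli_le _ (ltW h_gt0)).
    by rewrite ler_wpDl // ler_wpM2l.
  move: Hd; rewrite ltr_pdivrMr // => Hd.
  have D0 : 0 < 2 ^+ d :> R by rewrite exprn_gt0.
  rewrite -(ler_pM2r D0).
  rewrite (_ : k%:R * (8 / i%:R) * 2 ^+ d = 8 * (k%:R * (2 ^+ d / i%:R))); last by ring.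
  nra.
have xk0 : 0 < x * (1 + h) ^+ k by rewrite mulr_gt0 // exprn_gt0 // addr_gt0.
have xyk : x * (1 + h) ^+ k <= x * y by rewrite ler_pM2l.
have := mean_lipschitz g1 xk0 xyk.
have H2 : 2 * (1 - x * (1 + h) ^+ k / (x * y)) <= e / 3.
  rewrite -mulf_div divff ?gt_eqF // mul1r.
  have : h <= e / 6.
    apply: le_trans h_le _; rewrite -(invf_div 6) lef_pV2 ?posrE ?divr_gt0 ?exprn_gt0 //.
    exact: ltW.
  suff : 1 - (1 + h) ^+ k / y <= h by lra.
  have h10 : 0 < 1 + h by rewrite addr_gt0.
  have : (1 + h)^-1 <= (1 + h) ^+ k / y.
    rewrite ler_pdivlMr // mulrC ler_pdivrMr // -exprSr; exact: ltW.
  have : 1 - h <= (1 + h)^-1.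
    rewrite -(ler_pM2r h10) mulVf ?gt_eqF //; nra.
  lra.
have H3 : (x * y)^-1 <= e / 3.
  rewrite -(invf_div 3) lef_pV2 ?posrE ?mulr_gt0 ?invr_gt0 //.
  by apply: le_trans xe _; rewrite ler_peMr // ltW.
move=> H4; apply: le_trans (ler_distD (mean g (x * (1 + h) ^+ k)) _ _) _.
apply: le_trans (lerD H4 Hk) _; lra.
Qed.

(** In [rich_average] the dilations [x / (i * 2 ^ (3 * m - s))] range over a
    finite set fixed in advance, so [mean_dilate] removes them. *)
Lemma mean_shift (R : realType) (e : R) : 0 < e ->
  exists x0 : R, forall x, x0 <= x -> forall g, (forall k, `|g k| <= 1) ->
    `|mean g x - mean (g \o succn) x| <= e.
Proof.
move=> e0.
have [t Ht] : exists t, 12 / e < 2 ^+ t.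
  by exists (Num.bound (12 / e)); exact: upper_nthrootP.
have [s scales] := rich_scales R 0 t.
pose L : R := (2 ^ (s + 10))%:R / (e / 4) ^+ 2.
have [i [j [J [[si ij jN ijt] uJ rJ LJ]]]] := scales L.
have ltij : (i < j)%N by rewrite -addn1.
have iN : (2 ^ s <= i < 8 * 2 ^ s)%N by rewrite si (ltn_trans ltij).
have rJi : {in J, forall m, (s <= m)%N /\ rich m s i} by move=> m /rJ[].
have e4 : 0 < e / 4 by rewrite divr_gt0.
have bigLam : (2 ^ (s + 10))%:R <= (e / 4) ^+ 2 * \sum_(m <- J) (m.+1%:R^-1 : R).
  by rewrite -ler_pdivrMl ?exprn_gt0 // mulrC.
have [x1 Hi] := rich_average iN uJ rJi e4 bigLam.
have ti : (2 ^ t <= i)%N.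
  by apply: leq_trans (leq_trans ijt si); rewrite leq_pmull // subn_gt0.
have i0 : (0 < i)%N by apply: leq_trans ti; rewrite expn_gt0.
have i0' : 0 < i%:R :> R by rewrite ltr0n.
have i3 : 3 / i%:R <= e / 4.
  rewrite ler_pdivrMr //; move: Ht; rewrite ltr_pdivrMr //.
  have : 2 ^+ t <= i%:R :> R by rewrite -natrX ler_nat.
  nra.
pose D m := (i * 2 ^ (3 * m - s))%N.
have D0 m : 0 < (D m)%:R :> R by rewrite ltr0n muln_gt0 i0 expn_gt0.
pose Y : R := (\sum_(m <- J) D m)%:R.
have e2 : 0 < e / 2 by rewrite divr_gt0.
have [x2 Hd] := mean_dilate Y e2.
exists (Num.max x1 (Num.max x2 0 * Y)) => x; rewrite ge_max => /andP[xx1 xx2] g g1.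
have := Hi x xx1 g g1; set Lam := \sum_(_ <- _) _ in bigLam *.
have Lam0 : 0 < Lam.
  have : 0 < (e / 4) ^+ 2 * Lam.
    by apply: lt_le_trans bigLam; rewrite ltr0n expn_gt0.
  by rewrite pmulr_rgt0 // exprn_gt0.
have w_sum : \sum_(m <- J) (Lam * m.+1%:R)^-1 = 1.
  under eq_bigr => m _ do rewrite invfM.
  by rewrite -mulr_sumr mulVf ?gt_eqF.
set S := \sum_(_ <- _) _ => H1.
suff H2 : `|S - mean (g \o succn) x| <= e / 2.
  rewrite (_ : mean g x - _ = (mean g x - S) + (S - mean (g \o succn) x)); last by ring.
  apply: le_trans (ler_normD _ _) _; apply: le_trans (lerD H1 H2) _; lra.
have -> : mean (g \o succn) x
    = \sum_(m <- J) (Lam * m.+1%:R)^-1 * mean (g \o succn) x.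
  by rewrite -mulr_suml w_sum mul1r.
have -> : e / 2 = \sum_(m <- J) (Lam * m.+1%:R)^-1 * (e / 2).
  by rewrite -mulr_suml w_sum mul1r.
rewrite /S -sumrB; apply: le_trans (ler_norm_sum _ _ _) _.
rewrite big_seq [leRHS]big_seq; apply: ler_sum => m mJ.
have w0 : 0 <= (Lam * m.+1%:R)^-1 by rewrite invr_ge0 mulr_ge0 // ltW.
rewrite -mulrBr normrM (ger0_norm w0) ler_wpM2l // -/(D m).
have DY : (D m)%:R <= Y by rewrite ler_nat (bigD1_seq m) //= leq_addr.
have xD : x2 <= x / (D m)%:R.
  rewrite ler_pdivlMr //; apply: le_trans xx2.
  apply: (@le_trans _ _ (Num.max x2 0 * (D m)%:R)).
    by rewrite ler_pM2r // le_max lexx.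
  by rewrite ler_wpM2l // le_max lexx orbT.
have D1 : 1 <= ((D m)%:R : R) <= Y.
  by rewrite DY ler1n muln_gt0 i0 expn_gt0.
have := Hd _ xD _ D1 (g \o succn) (fun k => g1 k.+1).
by rewrite divfK ?gt_eqF // distrC.
Qed.

(** * Continuous weights and complex values *)

Lemma loglog_gt (R : realType) (K : R) :
  exists N0 : nat, forall N, (N0 <= N)%N -> K < Num.sqrt (ln (ln (N%:R : R))).
Proof.
exists (Num.bound (expR (expR (K ^+ 2)))) => N NN.
have h1 : expR (expR (K ^+ 2)) < N%:R.
  apply: (@lt_le_trans _ _ (Num.bound (expR (expR (K ^+ 2))))%:R); last by rewrite ler_nat.
  by rewrite archi_boundP // expR_ge0.
have N0 : 0 < N%:R :> R by apply: lt_trans h1; exact: expR_gt0.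
have h2 : expR (K ^+ 2) < ln (N%:R : R).
  by rewrite -ltr_expR lnK // posrE.
have l0 : 0 < ln (N%:R : R) by apply: lt_trans h2; exact: expR_gt0.
have h3 : K ^+ 2 < ln (ln (N%:R : R)).
  by rewrite -ltr_expR (@lnK _ (ln _)) // posrE.
have [K0|K0] := ltP K 0.
  by apply: lt_le_trans K0 _; exact: sqrtr_ge0.
rewrite -[K]ger0_norm // -sqrtr_sqr ltr_sqrt //.
by apply: le_lt_trans h3; exact: sqr_ge0.
Qed.

(** [mean_shift] for [g k = f ((k - L) / sqrt L) * a k], followed by moving the
    argument of [f] in [g k.+1] back by [1 / sqrt L]. *)
Lemma bounded_unif_cont_shift (R : realType) (f : R -> R) (a : nat -> R) (C A : R) :
  (forall x, `|f x| <= C) -> (forall k, `|a k| <= A) ->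
  (forall e, 0 < e -> exists2 dl, 0 < dl &
     forall x h, `|h| < dl -> `|f (x + h) - f x| <= e) ->
  forall e, 0 < e -> exists N0 : nat, forall N, (N0 <= N)%N ->
  `|N%:R^-1 * \sum_(1 <= n < N.+1)
      f (phi R N n) * (a (prime_Omega n) - a (prime_Omega n).+1)| <= e.
Proof.
move=> fC aA fu e e0.
have C0 : 0 <= C by apply: le_trans (fC 0).
have A0 : 0 <= A by apply: le_trans (aA 0%N).
pose M := C * A + 1.
have M0 : 0 < M by rewrite ltr_wpDl // mulr_ge0.
have A1 : 0 < A + 1 by rewrite ltr_wpDl.
have e2 : 0 < e / 2 by rewrite divr_gt0.
have [dl dl0 Hdl] := fu _ (divr_gt0 e2 A1).
have [x0 Hx0] := mean_shift (divr_gt0 e2 M0).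
have [N1 HN1] := loglog_gt (dl^-1).
exists (maxn 1 (maxn N1 (Num.bound `|x0|))) => N.
rewrite !geq_max => /and3P[Npos NN1 Nx0].
have Lpos := HN1 N NN1; set L := ln (ln _) in Lpos.
have sq0 : 0 < Num.sqrt L by apply: lt_trans Lpos; rewrite invr_gt0.
have N0 : 0 < N%:R :> R by rewrite ltr0n.
pose g k : R := f ((k%:R - L) / Num.sqrt L) * a k / M.
have g1 k : `|g k| <= 1.
  rewrite /g normrM [`|_^-1|]gtr0_norm ?invr_gt0 // ler_pdivrMr // mul1r normrM.
  by apply: le_trans (ler_pM _ _ (fC _) (aA _)) _ => //; rewrite lerDl.
have Nx : x0 <= N%:R.
  apply: (@le_trans _ _ (Num.bound `|x0|)%:R); last by rewrite ler_nat.
  exact: le_trans (ler_norm x0) (ltW (archi_boundP (normr_ge0 x0))).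
have := Hx0 _ Nx g g1; rewrite /mean natrK -mulrBr -sumrB.
set S1 := \sum_(_ <= _ < _) _ => H1.
rewrite (_ : N%:R^-1 * \sum_(1 <= n < N.+1) _ = M * (N%:R^-1 * S1)
   + N%:R^-1 * \sum_(1 <= n < N.+1) (f (phi R N n + (Num.sqrt L)^-1) - f (phi R N n))
       * a (prime_Omega n).+1); last first.
  rewrite mulrCA -mulrDr; congr (_ * _); rewrite /S1 mulr_sumr -big_split /=.
  apply: eq_bigr => n _; rewrite /g /= /phi -/L.
  have -> : ((prime_Omega n).+1%:R - L) / Num.sqrt L
      = ((prime_Omega n)%:R - L) / Num.sqrt L + (Num.sqrt L)^-1.
    by rewrite -natr1; ring.
  move: (f _) (f _) => u v; field; rewrite gt_eqF //.
apply: le_trans (ler_normD _ _) _; rewrite [e]splitr; apply: lerD.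
  by rewrite normrM gtr0_norm // mulrC -ler_pdivlMr.
rewrite normrM gtr0_norm ?invr_gt0 // ler_pdivrMl //.
apply: le_trans (ler_norm_sum _ _ _) _.
have -> : N%:R * (e / 2) = \sum_(1 <= n < N.+1) (e / 2).
  by rewrite sumr_const_nat subn1 mulr_natl.
apply: ler_sum => n _; rewrite normrM.
have Ldl : `|(Num.sqrt L)^-1| < dl.
  by rewrite gtr0_norm ?invr_gt0 // -[dl]invrK ltf_pV2 ?posrE ?invr_gt0.
apply: le_trans (ler_pM _ _ (Hdl (phi R N n) _ Ldl) (aA _)) _ => //.
rewrite -mulrA ler_piMr ?(ltW e2) // ler_pdivrMl // mulr1 lerDl //.
Qed.

(** Compactness gives a uniform modulus for base points [x] in [K]; if only
    [x + h] lies in [K], use [x + h] as base point and the increment [- h]. *)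
Lemma unif_cont_compact_support (R : realType) (f : R -> R) (K : set R) :
  continuous f -> compact K -> (forall x, ~ K x -> f x = 0) ->
  forall e, 0 < e -> exists2 dl, 0 < dl &
     forall x h, `|h| < dl -> `|f (x + h) - f x| <= e.
Proof.
move=> cf /compact_near_coveringP cK f0 e e0.
have : \forall h \near (0 : R), K `<=` (fun x => `|f (x + h) - f x| < e).
  apply: (cK R (nbhs (0 : R)) (fun h x => `|f (x + h) - f x| < e)) => x Kx.
  have : (fun z : R * R => f (z.1 + z.2) - f z.1) z @[z --> (x, 0 : R)] --> f (x + 0) - f x.
    apply: cvgB.
      apply: (cvg_comp (fun z : R * R => z.1 + z.2) f); last exact: cf.
      by apply: cvgD; [exact: cvg_fst | exact: cvg_snd].
    by apply: (cvg_comp fst f); [exact: cvg_fst | exact: cf].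
  rewrite addr0 subrr => /cvgr0Pnorm_lt/(_ e e0).
  exact.
move=> /nbhs_ballP[dl /= dl0 Hdl]; exists dl => // x h hdl.
have [Kx|nKx] := pselect (K x).
  by apply/ltW/Hdl => //; rewrite /ball /= sub0r normrN.
have [Kxh|nKxh] := pselect (K (x + h)); last by rewrite !f0 // subrr normr0 ltW.
have := Hdl (- h); rewrite /ball /= sub0r opprK => /(_ hdl) /(_ _ Kxh).
by rewrite addrK distrC => /ltW.
Qed.

Lemma bounded_compact_support (R : realType) (f : R -> R) (K : set R) :
  continuous f -> compact K -> (forall x, ~ K x -> f x = 0) ->
  exists C, forall x, `|f x| <= C.
Proof.
move=> cf cK f0.
have : compact (f @` K).
  apply: continuous_compact => //; exact: continuous_subspaceT.
move=> /compact_bounded [C [_ HC]]; exists (Num.max 0 (C + 1)) => x.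
rewrite le_max; have [Kx|nKx] := pselect (K x); last by rewrite f0 // normr0 lexx.
apply/orP; right; apply: HC; last by exists x.
by rewrite ltrDl.
Qed.

Lemma Re_Im_sub_le (R : rcfType) (u v : R[i]) :
  `|complex.Re u - complex.Re v|%:C <= `|u - v| /\
  `|complex.Im u - complex.Im v|%:C <= `|u - v|.
Proof.
case: u v => [a b] [c d] /=; rewrite normc_def /= !lecR -!sqrtr_sqr.
by split; rewrite ler_wsqrtr // ?lerDl ?lerDr sqr_ge0.
Qed.

Lemma continuous_Re_Im (R : realType) (F : R -> R[i]) : continuous F ->
  continuous (fun x => complex.Re (F x)) /\ continuous (fun x => complex.Im (F x)).
Proof.
move=> cF; split => x; apply/cvgrPdist_lt => e e0.
  have /cvgrPdist_lt/(_ e%:C) := cF x; rewrite ltcR => /(_ e0).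
  apply: filterS => y; rewrite -ltcR; apply: le_lt_trans.
  by have [] := Re_Im_sub_le (F x) (F y).
have /cvgrPdist_lt/(_ e%:C) := cF x; rewrite ltcR => /(_ e0).
apply: filterS => y; rewrite -ltcR; apply: le_lt_trans.
by have [] := Re_Im_sub_le (F x) (F y).
Qed.

Lemma bounded_Re_Im (R : realType) (a : nat -> R[i]) : bounded_fun a ->
  exists A, (forall k, `|complex.Re (a k)| <= A) /\ (forall k, `|complex.Im (a k)| <= A).
Proof.
move=> [M [_ HM]]; exists (complex.Re (M + 1)).
have aM k : `|a k| <= M + 1 by apply: HM => //; rewrite ltrDl.
suff H k : `|complex.Re (a k)| <= complex.Re (M + 1) /\ `|complex.Im (a k)| <= complex.Re (M + 1).
  by split=> k; have [] := H k.
have [hr hi] := Re_Im_sub_le (a k) 0; rewrite !subr0 in hr hi.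
have := le_trans hr (aM k); have := le_trans hi (aM k).
by rewrite !lecE => /andP[_ ->] /andP[_ ->].
Qed.

Theorem proposition4p5 (R : realType) (F : R -> R[i]) (hF : Cc F)
    (a : nat -> R[i]) (ha : bounded_fun a) :
  (fun N : nat => N%:R^-1 *
     \sum_(1 <= n < N.+1) F (phi R N n) * a (prime_Omega n))
  = (fun N : nat => N%:R^-1 *
     \sum_(1 <= n < N.+1) F (phi R N n) * a (prime_Omega n).+1)
  +o_\oo (fun=> 1 : R[i]).
Proof.
have [cF cK] := hF; set K := closure _ in cK.
have F0 x : ~ K x -> F x = 0.
  by move=> nK; apply/eqP/negPn/negP => /(@subset_closure _ [set x | F x != 0]).
have [cf1 cf2] := continuous_Re_Im cF; have [A [aA1 aA2]] := bounded_Re_Im ha.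
set f1 := fun x => complex.Re (F x) in cf1; set f2 := fun x => complex.Im (F x) in cf2.
have z1 x : ~ K x -> f1 x = 0 by move=> /F0; rewrite /f1 => ->.
have z2 x : ~ K x -> f2 x = 0 by move=> /F0; rewrite /f2 => ->.
have [C1 b1] := bounded_compact_support cf1 cK z1.
have [C2 b2] := bounded_compact_support cf2 cK z2.
have u1 := unif_cont_compact_support cf1 cK z1.
have u2 := unif_cont_compact_support cf2 cK z2.
set a1 := fun k => complex.Re (a k) in aA1; set a2 := fun k => complex.Im (a k) in aA2.
pose D f (a : nat -> R) N := N%:R^-1 * \sum_(1 <= n < N.+1)
  f (phi R N n) * (a (prime_Omega n) - a (prime_Omega n).+1).
apply/eqaddoE; apply/eqaddoP => eps eps0.
have [e e0 ->] : exists2 e : R, 0 < e & eps = e%:C.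
  exists (complex.Re eps); first by move: eps0; rewrite ltcE => /andP[].
  by rewrite RRe_real // gtr0_real.
have e4 : 0 < e / 4 by rewrite divr_gt0.
have [N1 H1] := bounded_unif_cont_shift b1 aA1 u1 e4.
have [N2 H2] := bounded_unif_cont_shift b2 aA2 u2 e4.
have [N3 H3] := bounded_unif_cont_shift b1 aA2 u1 e4.
have [N4 H4] := bounded_unif_cont_shift b2 aA1 u2 e4.
exists (maxn (maxn N1 N2) (maxn N3 N4)) => // N /=.
rewrite !geq_max => /andP[/andP[n1 n2] /andP[n3 n4]].
rewrite normr1 mulr1.
have -> : ((fun N : nat => N%:R^-1 *
     \sum_(1 <= n < N.+1) F (phi R N n) * a (prime_Omega n))
  - (fun N : nat => N%:R^-1 *
     \sum_(1 <= n < N.+1) F (phi R N n) * a (prime_Omega n).+1)) N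
  = (D f1 a1 N)%:C - (D f2 a2 N)%:C + 'i%C * ((D f1 a2 N)%:C + (D f2 a1 N)%:C).
  rewrite /D !fctE -mulrBr -sumrB !rmorphM !fmorphV !rmorph_nat /=.
  rewrite -mulrBr -mulrDr mulrCA -mulrDr; congr (_ * _).
  rewrite !rmorph_sum -sumrB -big_split /= mulr_sumr -big_split /=.
  apply: eq_bigr => n _.
  rewrite !rmorphM !rmorphB /= /f1 /f2 /a1 /a2.
  rewrite {1 2}[F _]complexE {1}[a _]complexE {1}[a _.+1]complexE.
  have i2 := sqr_i R.
  ring: i2.
have normC (x : R) : `|x%:C| = `|x|%:C by rewrite normc_def /= expr0n addr0 sqrtr_sqr.
have normi : `|'i%C : R[i]| = 1 by rewrite normc_def /= expr0n add0r expr1n sqrtr1.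
apply: le_trans (ler_normD _ _) _; rewrite normrM normi mul1r.
apply: le_trans (lerD (ler_normB _ _) (ler_normD _ _)) _.
rewrite !normC -!rmorphD lecR.
have := H1 N n1; have := H2 N n2; have := H3 N n3; have := H4 N n4.
rewrite -/(D f1 a1 N) -/(D f2 a2 N) -/(D f1 a2 N) -/(D f2 a1 N); lra.
Qed.
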